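(* Fix a type $\tau$. Let $\mathbf{Lat}$ be the category of complete lattices whose morphisms are maps preserving $0$, $1$, binary meets and arbitrary joins; let $\mathbf{Rel}_\tau$ be the category of relational structures of type $\tau$ with $p$-morphisms; let $\mathbf{Alg}_\tau$ be the category of complete lattices equipped with operations $(f_i)_{i\in I}$ of type $\tau$, whose morphisms are maps preserving $0,1$, binary meets, binary joins and each $f_i$. Then: (a) The assignment $(L,\mathfrak{X})\mapsto L^{\mathfrak{X}}$, sending a morphism $\phi:L\to M$ of $\mathbf{Lat}$ to $\phi^{\mathfrak{X}}:L^{\mathfrak{X}}\to M^{\mathfrak{X}}$, $\phi^{\mathfrak{X}}(\alpha)=\phi\circ\alpha$, and a $p$-morphism $p:\mathfrak{X}\to\mathfrak{Y}$ to $p^L:L^{\mathfrak{Y}}\to L^{\mathfrak{X}}$, $p^L(\beta)=\beta\circ p$, is a bifunctor $\mathbf{Lat}\times\mathbf{Rel}_\tau\to\mathbf{Alg}_\tau$, covariant in the first argument and contravariant in the second (in particular all $\phi^{\mathfrak{X}}$ and $p^L$ are morphisms of $\mathbf{Alg}_\tau$). (b) For any family $(L_j)_{j\in J}$ of complete lattices, $(\prod_J L_j)^{\mathfrak{X}}\cong\prod_J L_j^{\mathfrak{X}}$ as algebras (bounded lattice operations and the $f_i$). (c) For any family $(\mathfrak{X}_j)_{j\in J}$ of relational structures of type $\tau$ with disjoint union (coproduct) $\bigoplus_J\mathfrak{X}_j$, $L^{\bigoplus_J\mathfrak{X}_j}\cong\prod_J L^{\mathfrak{X}_j}$. (d) If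 $\phi$ is one-one (resp. onto) then $\phi^{\mathfrak{X}}$ is one-one (resp. onto); if $X$ has at least one element, the converses hold as well. (e) If a $p$-morphism $p$ is one-one then $p^L$ is onto, and if $p$ is onto then $p^L$ is one-one.
   Context: A type is $\tau:I\to\mathbb{N}$, $n_i=\tau(i)$. A relational structure of type $\tau$ is $\mathfrak{X}=(X,(R_i)_{i\in I})$ with $R_i\subseteq X^{n_i+1}$. For a complete lattice $L$, $L^{\mathfrak{X}}$ is the set of functions $X\to L$ with pointwise $\wedge,\vee,0,1$ and operations $f_i(\alpha_1,\ldots,\alpha_{n_i})(x)=\bigvee\{\alpha_1(x_1)\wedge\cdots\wedge\alpha_{n_i}(x_{n_i}):(x_1,\ldots,x_{n_i},x)\in R_i\}$. For relational structures $\mathfrak{X}=(X,(R_i))$, $\mathfrak{Y}=(Y,(S_i))$ of type $\tau$, a $p$-morphism is a function $p:X\to Y$ such that for each $i\in I$ and $x\in X$: $\{(y_1,\ldots,y_{n_i}):(y_1,\ldots,y_{n_i},p(x))\in S_i\}=\{(p(x_1),\ldots,p(x_{n_i})):(x_1,\ldots,x_{n_i},x)\in R_i\}$. The disjoint union $\bigoplus_J\mathfrak{X}_j$ has universe the disjoint union of the $X_j$ and $i$-th relation the union of the $i$-th relations of the $\mathfrak{X}_j$. *)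

(* Defs.v *)
From HB Require Import structures.
From mathcomp Require Import all_boot all_order.
From mathcomp Require Import boolp classical_sets functions.

Set Implicit Arguments.
Unset Strict Implicit.
Unset Printing Implicit Defensive.

Import Order.TTheory.

Local Open Scope classical_set_scope.

(* Orders live on a choiceType; this loses no generality, since with the
   axioms of boolp every type carries such a structure. *)

HB.mixin Record isCompleteLattice d T of Order.TBLattice d T := {
  csup : set T -> T;
  cinf : set T -> T;
  csup_upper : forall (A : set T) x, A x -> (x <= csup A)%O;
  csup_least : forall (A : set T) y,
    (forall x, A x -> (x <= y)%O) -> (csup A <= y)%O;
  cinf_lower : forall (A : set T) x, A x -> (cinf A <= x)%O;
  cinf_greatest : forall (A : set T) y,
    (forall x, A x -> (y <= x)%O) -> (y <= cinf A)%O
}.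

#[short(type="completeLatticeType")]
HB.structure Definition CompleteLattice d :=
  { T of isCompleteLattice d T & Order.TBLattice d T }.

(* The display is only a printing tag, so it is hidden in the object. *)
Record completeLat := CompleteLat {
  lat_disp : Order.disp_t;
  lat_sort :> completeLatticeType lat_disp
}.

(* X -> L: boolp already provides the pointwise order, meet and join. *)
Section FunctionLattice.
Context (X : Type) (d : Order.disp_t) (L : completeLatticeType d).

Let fbot : X -> L := fun=> \bot%O.
Let ftop : X -> L := fun=> \top%O.

Let fbotP (f : X -> L) : (fbot <= f)%O.
Proof. by apply/lefP => x; apply: le0x. Qed.

Let ftopP (f : X -> L) : (f <= ftop)%O.
Proof. by apply/lefP => x; apply: lex1. Qed.

HB.instance Definition _ :=
  @Order.hasBottom.Build _ (X -> L) fbot fbotP.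
HB.instance Definition _ :=
  @Order.hasTop.Build _ (X -> L) ftop ftopP.

Let fsup (A : set (X -> L)) : X -> L := fun x => csup [set f x | f in A].
Let finf (A : set (X -> L)) : X -> L := fun x => cinf [set f x | f in A].

Let fsup_upper (A : set (X -> L)) f : A f -> (f <= fsup A)%O.
Proof. by move=> Af; apply/lefP => x; apply: csup_upper; exists f. Qed.

Let fsup_least (A : set (X -> L)) g :
  (forall f, A f -> (f <= g)%O) -> (fsup A <= g)%O.
Proof.
move=> Ag; apply/lefP => x; apply: csup_least => _ [f Af <-].
exact: (lefP _ _ (Ag f Af)).
Qed.

Let finf_lower (A : set (X -> L)) f : A f -> (finf A <= f)%O.
Proof. by move=> Af; apply/lefP => x; apply: cinf_lower; exists f. Qed.

Let finf_greatest (A : set (X -> L)) g :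
  (forall f, A f -> (g <= f)%O) -> (g <= finf A)%O.
Proof.
move=> Ag; apply/lefP => x; apply: cinf_greatest => _ [f Af <-].
exact: (lefP _ _ (Ag f Af)).
Qed.

HB.instance Definition _ := @isCompleteLattice.Build _ (X -> L)
  fsup finf fsup_upper fsup_least finf_lower finf_greatest.

End FunctionLattice.

Definition fun_lat (X : Type) (L : completeLat) : completeLat :=
  CompleteLat (X -> L : completeLatticeType _).

(* A named carrier, since boolp orders only non-dependent function types. *)
Definition dprod (J : Type) (L : J -> completeLat) : Type := forall j, L j.

Section ProductLattice.
Context (J : Type) (L : J -> completeLat).
Notation P := (dprod L).

HB.instance Definition _ := Choice.copy P (forall j, L j).

Let ple (f g : P) : bool := `[< forall j, (f j <= g j)%O >].
Let plt (f g : P) : bool := (g != f) && ple f g.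
Let pmeet (f g : P) : P := fun j => (f j `&` g j)%O.
Let pjoin (f g : P) : P := fun j => (f j `|` g j)%O.

Let pltE (f g : P) : plt f g = (g != f) && ple f g.
Proof. by []. Qed.

Let ple_refl : reflexive ple.
Proof. by move=> f; apply/asboolP. Qed.

Let ple_anti : antisymmetric ple.
Proof.
move=> f g /andP[/asboolP fg /asboolP gf].
by apply: functional_extensionality_dep => j; apply/le_anti/andP.
Qed.

Let ple_trans : transitive ple.
Proof.
move=> g f h /asboolP fg /asboolP gh; apply/asboolP => j.
exact: le_trans (fg j) (gh j).
Qed.

HB.instance Definition _ := @Order.isPOrder.Build FunOrder.fun_display P
  ple plt pltE ple_refl ple_anti ple_trans.

Let le_dprodP (f g : P) : reflect (forall j, (f j <= g j)%O) (f <= g)%O.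
Proof. exact: asboolP. Qed.

Let pmeetP (f g h : P) : (f <= pmeet g h)%O = (f <= g)%O && (f <= h)%O.
Proof.
apply/le_dprodP/andP => [fgh|[/le_dprodP fg /le_dprodP fh] j].
  by split; apply/le_dprodP => j; have := fgh j; rewrite lexI => /andP[].
by rewrite lexI fg fh.
Qed.

Let pjoinP (f g h : P) : (pjoin f g <= h)%O = (f <= h)%O && (g <= h)%O.
Proof.
apply/le_dprodP/andP => [fgh|[/le_dprodP fh /le_dprodP gh] j].
  by split; apply/le_dprodP => j; have := fgh j; rewrite leUx => /andP[].
by rewrite leUx fh gh.
Qed.

HB.instance Definition _ := @Order.POrder_isMeetSemilattice.Build _ P
  pmeet pmeetP.
HB.instance Definition _ := @Order.POrder_isJoinSemilattice.Build _ P
  pjoin pjoinP.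

Let pbot : P := fun=> \bot%O.
Let ptop : P := fun=> \top%O.

Let pbotP (f : P) : (pbot <= f)%O.
Proof. by apply/le_dprodP => j; apply: le0x. Qed.

Let ptopP (f : P) : (f <= ptop)%O.
Proof. by apply/le_dprodP => j; apply: lex1. Qed.

HB.instance Definition _ := @Order.hasBottom.Build _ P pbot pbotP.
HB.instance Definition _ := @Order.hasTop.Build _ P ptop ptopP.

Let psup (A : set P) : P := fun j => csup [set f j | f in A].
Let pinf (A : set P) : P := fun j => cinf [set f j | f in A].

Let psup_upper (A : set P) f : A f -> (f <= psup A)%O.
Proof. by move=> Af; apply/le_dprodP => j; apply: csup_upper; exists f. Qed.

Let psup_least (A : set P) g :
  (forall f, A f -> (f <= g)%O) -> (psup A <= g)%O.
Proof.
move=> Ag; apply/le_dprodP => j; apply: csup_least => _ [f Af <-].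
exact: (le_dprodP _ _ (Ag f Af)).
Qed.

Let pinf_lower (A : set P) f : A f -> (pinf A <= f)%O.
Proof. by move=> Af; apply/le_dprodP => j; apply: cinf_lower; exists f. Qed.

Let pinf_greatest (A : set P) g :
  (forall f, A f -> (g <= f)%O) -> (g <= pinf A)%O.
Proof.
move=> Ag; apply/le_dprodP => j; apply: cinf_greatest => _ [f Af <-].
exact: (le_dprodP _ _ (Ag f Af)).
Qed.

HB.instance Definition _ := @isCompleteLattice.Build _ P
  psup pinf psup_upper psup_least pinf_lower pinf_greatest.

End ProductLattice.

Definition prod_lat (J : Type) (L : J -> completeLat) : completeLat :=
  CompleteLat (dprod L : completeLatticeType _).

Definition lat_morphism (L M : completeLat) (phi : L -> M) : Prop :=
  [/\ phi \bot%O = \bot%O,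
      phi \top%O = \top%O,
      forall a b : L, phi (a `&` b)%O = (phi a `&` phi b)%O
    & forall A : set L, phi (csup A) = csup [set phi a | a in A]].

Section Structures.
Context (I : Type) (tau : I -> nat).

Record relStruct := RelStruct {
  rel_car :> Type;
  rel_rel : forall i : I, set ((tau i).+1.-tuple rel_car)
}.
Arguments rel_rel : clear implicits.

(* The tuples (x_1, ..., x_{n_i}) with (x_1, ..., x_{n_i}, x) in R_i. *)
Definition rel_fiber (X : relStruct) (i : I) (x : X) :
    set ((tau i).-tuple X) :=
  [set s | rel_rel X i (rcons_tuple s x)].
Arguments rel_fiber {X} i x.

Definition p_morphism (X Y : relStruct) (p : X -> Y) : Prop :=
  forall (i : I) (x : X),
    rel_fiber i (p x) = [set map_tuple p s | s in rel_fiber i x].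

Definition disjoint_union (J : Type) (X : J -> relStruct) : relStruct :=
  @RelStruct {j : J & X j} (fun i =>
    \bigcup_j [set map_tuple (existT X j) s | s in rel_rel (X j) i]).

Record latAlg := LatAlg {
  alg_lat :> completeLat;
  alg_op : forall i : I, (tau i).-tuple alg_lat -> alg_lat
}.
Arguments alg_op : clear implicits.

Definition alg_morphism (A B : latAlg) (h : A -> B) : Prop :=
  [/\ h \bot%O = \bot%O,
      h \top%O = \top%O,
      forall a b : A, h (a `&` b)%O = (h a `&` h b)%O,
      forall a b : A, h (a `|` b)%O = (h a `|` h b)%O
    & forall (i : I) (t : (tau i).-tuple A),
        h (alg_op A i t) = alg_op B i (map_tuple h t)].

Definition alg_iso (A B : latAlg) : Prop :=
  exists h : A -> B, alg_morphism h /\ bijective h.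

Definition prod_alg (J : Type) (A : J -> latAlg) : latAlg :=
  @LatAlg (prod_lat A)
    (fun i t j => alg_op (A j) i (map_tuple (fun a => a j) t)).

(* For n_i = 0 the meet is \top and f_i is a constant. *)
Definition pow_op (L : completeLat) (X : relStruct) (i : I)
    (a : (tau i).-tuple (fun_lat X L)) : fun_lat X L :=
  fun x => csup [set (\meet_(k < tau i) tnth a k (tnth s k))%O
                | s in rel_fiber i x].

Definition pow_alg (L : completeLat) (X : relStruct) : latAlg :=
  LatAlg (@pow_op L X).

Definition pow_lat_map (L M : completeLat) (X : relStruct) (phi : L -> M) :
    pow_alg L X -> pow_alg M X :=
  fun alpha => phi \o alpha.

Definition pow_rel_map (L : completeLat) (X Y : relStruct) (p : X -> Y) :
    pow_alg L Y -> pow_alg L X :=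
  fun beta => beta \o p.

End Structures.

Arguments rel_rel {I tau} r i.
Arguments rel_fiber {I tau X} i x.
Arguments alg_op {I tau} l i _.
Arguments pow_lat_map {I tau L M} X phi _.
Arguments pow_rel_map {I tau} L {X Y} p _.

Record category := Category {
  cat_obj :> Type;
  hom : cat_obj -> cat_obj -> Type;
  cat_id : forall a, hom a a;
  cat_comp : forall a b c, hom b c -> hom a b -> hom a c;
  cat_comp_id : forall a b (f : hom a b), cat_comp f (cat_id a) = f;
  cat_id_comp : forall a b (f : hom a b), cat_comp (cat_id b) f = f;
  cat_compA : forall a b c d (h : hom c d) (g : hom b c) (f : hom a b),
    cat_comp h (cat_comp g f) = cat_comp (cat_comp h g) f
}.

Definition op_cat (C : category) : category :=
  @Category C (fun a b => hom b a) (@cat_id C)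
    (fun a b c g f => cat_comp f g)
    (fun a b f => cat_id_comp f)
    (fun a b f => cat_comp_id f)
    (fun a b c d h g f => esym (cat_compA f g h)).

Section ProductCategory.
Context (C D : category).

Definition prod_hom (a b : C * D) : Type := (hom a.1 b.1 * hom a.2 b.2)%type.

Definition prod_comp (a b c : C * D) (g : prod_hom b c) (f : prod_hom a b) :
    prod_hom a c :=
  (cat_comp g.1 f.1, cat_comp g.2 f.2).

Definition prod_cat : category.
Proof.
refine (@Category (C * D)%type prod_hom
  (fun a => (cat_id a.1, cat_id a.2)) prod_comp _ _ _).
- by move=> a b [f f']; rewrite /prod_comp /= !cat_comp_id.
- by move=> a b [f f']; rewrite /prod_comp /= !cat_id_comp.
- by move=> a b c d h g f; rewrite /prod_comp /= !cat_compA.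
Defined.

End ProductCategory.

Definition is_functor (C D : category) (F0 : C -> D)
    (F1 : forall a b : C, hom a b -> hom (F0 a) (F0 b)) : Prop :=
  (forall a : C, F1 a a (cat_id a) = cat_id (F0 a)) /\
  (forall (a b c : C) (g : hom b c) (f : hom a b),
     F1 a c (cat_comp g f) = cat_comp (F1 b c g) (F1 a b f)).

(* Categories whose morphisms are the maps satisfying a given property. *)
Section ConcreteCategory.
Context (O : Type) (car : O -> Type).
Context (mor : forall a b : O, (car a -> car b) -> Prop).
Context (mor_id : forall a, mor (@id (car a))).
Context (mor_comp : forall (a b c : O) (g : car b -> car c) (f : car a -> car b),
  mor g -> mor f -> mor (g \o f)).

Definition concrete_hom (a b : O) : Type := {f : car a -> car b | mor f}.

Definition concrete_comp (a b c : O) (g : concrete_hom b c)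
    (f : concrete_hom a b) : concrete_hom a c :=
  exist _ (sval g \o sval f) (mor_comp (svalP g) (svalP f)).

Definition concrete_cat : category.
Proof.
refine (@Category O concrete_hom
  (fun a => exist _ (@id (car a)) (mor_id a)) concrete_comp _ _ _).
- by move=> a b [f fP]; apply: eq_exist.
- by move=> a b [f fP]; apply: eq_exist.
- by move=> a b c d [h hP] [g gP] [f fP]; apply: eq_exist.
Defined.

End ConcreteCategory.

Lemma lat_morphism_id (L : completeLat) : lat_morphism (@id L).
Proof. by split=> // A; rewrite image_id. Qed.

Lemma lat_morphism_comp (L M N : completeLat) (g : M -> N) (f : L -> M) :
  lat_morphism g -> lat_morphism f -> lat_morphism (g \o f).
Proof.
move=> [g0 g1 gI gS] [f0 f1 fI fS]; split=> /= [| |a b|A].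
- by rewrite f0 g0.
- by rewrite f1 g1.
- by rewrite fI gI.
- by rewrite fS gS image_comp.
Qed.

Definition Lat : category := concrete_cat lat_morphism_id lat_morphism_comp.

Section RelAlg.
Context (I : Type) (tau : I -> nat).

Lemma p_morphism_id (X : relStruct tau) : p_morphism (@id X).
Proof.
move=> i x; apply/seteqP; split=> [s Rs|_ [s Rs <-]].
  by exists s => //; apply: val_inj; rewrite /= map_id.
by suff -> : map_tuple id s = s by []; apply: val_inj; rewrite /= map_id.
Qed.

Lemma p_morphism_comp (X Y Z : relStruct tau) (g : Y -> Z) (f : X -> Y) :
  p_morphism g -> p_morphism f -> p_morphism (g \o f).
Proof.
move=> gP fP i x; rewrite /= gP fP image_comp.
by apply: eq_imagel => s _; apply: val_inj; rewrite /= map_comp.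
Qed.

Definition Rel : category := concrete_cat p_morphism_id p_morphism_comp.

Lemma alg_morphism_id (A : latAlg tau) : alg_morphism (@id A).
Proof.
split=> // i t; congr (alg_op A i _).
by apply: val_inj; rewrite /= map_id.
Qed.

Lemma alg_morphism_comp (A B C : latAlg tau) (g : B -> C) (f : A -> B) :
  alg_morphism g -> alg_morphism f -> alg_morphism (g \o f).
Proof.
move=> [g0 g1 gI gU gop] [f0 f1 fI fU fop]; split=> /= [| |a b|a b|i t].
- by rewrite f0 g0.
- by rewrite f1 g1.
- by rewrite fI gI.
- by rewrite fU gU.
- by rewrite fop gop; congr (alg_op C i _); apply: val_inj; rewrite /= map_comp.
Qed.

Definition Alg : category := concrete_cat alg_morphism_id alg_morphism_comp.

End RelAlg.

(* Main.v *)
(* L^X is functorial in each variable, and a family of morphisms A -> B_j is the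
   same as a morphism from A to the product.  Applied to the projections of
   prod_J L_j, respectively to the inclusions of the X_j in their disjoint
   union, this makes the comparison maps of (b) and (c) morphisms; both are
   currying bijections. *)
Require Import Defs.
From mathcomp Require Import all_boot all_order.
From mathcomp Require Import boolp classical_sets functions.

Set Implicit Arguments.
Unset Strict Implicit.
Unset Printing Implicit Defensive.

Import Order.TTheory.

Local Open Scope classical_set_scope.

(** Morphisms of [Lat] are given as preserving [csup]; writing a binary join as the supremum of a
    pair lets them preserve [|] as well, as [Alg] requires. *)
Lemma csup_pair (L : completeLat) (a b : L) :
  csup [set a; b] = (a `|` b)%O.
Proof.
apply/le_anti/andP; split.
  by apply: csup_least => x [] ->; [exact: leUl | exact: leUr].
by rewrite leUx; apply/andP; split; apply: csup_upper; [left | right].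
Qed.

Lemma lat_morphism_join (L M : completeLat) (phi : L -> M) :
  lat_morphism phi -> forall a b : L, phi (a `|` b)%O = (phi a `|` phi b)%O.
Proof.
move=> [_ _ _ phiS] a b.
by rewrite -!csup_pair phiS image_setU !image_set1.
Qed.

Lemma lat_morphism_proj (J : Type) (L : J -> completeLat) (j : J) :
  lat_morphism (fun f : prod_lat L => f j).
Proof. by split. Qed.

Section Powers.
Context (I : Type) (tau : I -> nat).

(** Each $f_i$ is a supremum of finite meets, and [phi] commutes with both. *)
Lemma pow_lat_map_morphism (L M : completeLat) (X : relStruct tau)
    (phi : L -> M) :
  lat_morphism phi -> alg_morphism (pow_lat_map X phi).
Proof.
move=> phiP; have [phi0 phi1 phiI phiS] := phiP.
split=> [||a b|a b|i t]; apply/funext => x.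
- exact: phi0.
- exact: phi1.
- exact: phiI.
- exact: lat_morphism_join.
- rewrite /pow_lat_map /= /pow_op phiS image_comp; congr (csup _).
  (* The iterated meet has unit [\top], so [phi1] enters here; it settles the case [tau i = 0]. *)
  apply: eq_imagel => s _ /=; rewrite (big_morph phi phiI phi1).
  by apply: eq_bigr => k _; rewrite tnth_map.
Qed.

(** The fiber over [p x] is the image of the fiber over [x], so both suprema range over the same
    meets. The lattice operations are pointwise and commute with precomposition by conversion. *)
Lemma pow_rel_map_morphism (L : completeLat) (X Y : relStruct tau)
    (p : X -> Y) :
  p_morphism p -> alg_morphism (pow_rel_map L p).
Proof.
move=> pP; split=> // i t; apply/funext => x.
rewrite /pow_rel_map /= /pow_op pP image_comp; congr (csup _).
by apply: eq_imagel => s _ /=; apply: eq_bigr => k _; rewrite !tnth_map.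
Qed.

Lemma prod_alg_morphism (J : Type) (A : latAlg tau) (B : J -> latAlg tau)
    (h : forall j, A -> B j) :
  (forall j, alg_morphism (h j)) ->
  alg_morphism (fun a => (fun j => h j a) : prod_alg B).
Proof.
move=> hP; split=> [||a b|a b|i t]; apply: functional_extensionality_dep => j;
  have [h0 h1 hI hU hop] := hP j.
- exact: h0.
- exact: h1.
- exact: hI.
- exact: hU.
- rewrite hop /=; congr (alg_op (B j) i _).
  by apply: val_inj; rewrite /= -map_comp.
Qed.

(** A tuple related in the union comes from a single summand, and its last entry determines which
    one. *)
Lemma disjoint_union_inj_morphism (J : Type) (X : J -> relStruct tau) (j : J) :
  p_morphism (existT X j : X j -> disjoint_union X).
Proof.
move=> i x; apply/seteqP; split=> [s|_ [s Rs <-]]; last first.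
  exists j => //; exists (rcons_tuple s x) => //.
  by apply: val_inj; rewrite /= map_rcons.
move=> [k _ [u Ru /(congr1 val)/=]].
(* A tuple of length [(tau i).+1] is nonempty; its last entry [y] is split off to be compared with
   [x]. *)
case: u Ru => u; case: (lastP u) => // {}u y szu Ru; rewrite map_rcons.
move=> /rcons_inj e.
have us : map (existT X k) u = s := congr1 fst e.
have yx : existT X k y = existT X j x := congr1 snd e.
(* Transporting along yx as a whole spares the injectivity of existT. *)
pose image_fiber (w : {j & X j}) :=
  [set map_tuple (existT X (projT1 w)) r | r in rel_fiber i (projT2 w)] s.
change (image_fiber (existT X j x)); rewrite -yx /image_fiber /=.
have szu' : size u == tau i by move: (szu); rewrite size_rcons.
exists (Tuple szu'); last exact: val_inj.
rewrite /rel_fiber /=.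
suff -> : rcons_tuple (Tuple szu') y = Tuple szu by []; exact: val_inj.
Qed.

Lemma pow_prod_iso (J : Type) (L : J -> completeLat) (X : relStruct tau) :
  alg_iso (pow_alg (prod_lat L) X) (prod_alg (fun j => pow_alg (L j) X)).
Proof.
exists (fun a j => pow_lat_map X (fun f : prod_lat L => f j) a); split.
  by apply: prod_alg_morphism => j; exact/pow_lat_map_morphism/lat_morphism_proj.
by exists (fun b x j => b j x).
Qed.

Lemma pow_disjoint_union_iso (J : Type) (X : J -> relStruct tau)
    (L : completeLat) :
  alg_iso (pow_alg L (disjoint_union X)) (prod_alg (fun j => pow_alg L (X j))).
Proof.
exists (fun a j => pow_rel_map L (existT X j : _ -> disjoint_union X) a); split.
  apply: prod_alg_morphism => j.
  exact/pow_rel_map_morphism/disjoint_union_inj_morphism.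
(* Uncurrying is the inverse; the composite on functions of [u] needs [u] destructed into a pair. *)
exists (fun b (u : disjoint_union X) => b (projT1 u) (projT2 u)) => [a|b] //.
by apply/funext => -[j x].
Qed.

Lemma pow_lat_map_inj (L M : completeLat) (X : relStruct tau) (phi : L -> M) :
  injective phi -> injective (pow_lat_map X phi).
Proof.
move=> phi_inj a b ab; apply/funext => x; apply: phi_inj.
exact: (congr1 (@^~ x) ab).
Qed.

Lemma pow_lat_map_surj (L M : completeLat) (X : relStruct tau) (phi : L -> M) :
  set_surj setT setT phi -> set_surj setT setT (pow_lat_map X phi).
Proof.
move=> phi_surj b _.
(* The axiom of choice selects a preimage of [b x] for all [x] at once. *)
have /choice[a aP] : forall x, exists l, phi l = b x.
  by move=> x; have [l _ <-] := phi_surj (b x) Logic.I; exists l.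
by exists a => //; apply/funext.
Qed.

(** Elements of the lattice are viewed as constant functions and recovered by evaluation at a point
    of [X]. *)
Lemma inj_pow_lat_map (L M : completeLat) (X : relStruct tau) (phi : L -> M) :
  inhabited X -> injective (pow_lat_map X phi) -> injective phi.
Proof.
move=> [x] phiX_inj a b ab.
have /(congr1 (@^~ x)) // : (fun=> a) = (fun=> b) :> pow_alg L X.
by apply: phiX_inj; apply/funext => y.
Qed.

Lemma surj_pow_lat_map (L M : completeLat) (X : relStruct tau) (phi : L -> M) :
  inhabited X -> set_surj setT setT (pow_lat_map X phi) ->
  set_surj setT setT phi.
Proof.
move=> [x] phiX_surj b _; have [a _ ab] := phiX_surj (fun=> b) Logic.I.
by exists (a x) => //; exact: (congr1 (@^~ x) ab).
Qed.

Lemma pow_rel_map_surj (L : completeLat) (X Y : relStruct tau) (p : X -> Y) :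
  injective p -> set_surj setT setT (pow_rel_map L p).
Proof.
move=> p_inj a _.
(* This extends [a] along [p]: by injectivity the fiber over [p x] is the singleton of [x], and
   outside the image the empty supremum gives [\bot]. *)
exists (fun y => csup [set a x | x in [set x | p x = y]]) => //.
apply/funext => x; rewrite /pow_rel_map /=; apply/le_anti/andP; split.
  by apply: csup_least => _ [z /p_inj -> <-].
by apply: csup_upper; exists x.
Qed.

Lemma pow_rel_map_inj (L : completeLat) (X Y : relStruct tau) (p : X -> Y) :
  set_surj setT setT p -> injective (pow_rel_map L p).
Proof.
move=> p_surj a b ab; apply/funext => y; have [x _ <-] := p_surj y Logic.I.
exact: (congr1 (@^~ x) ab).
Qed.

(** For [f] = $(\phi, p)$ this is $\alpha \mapsto \phi \circ \alpha \circ p$, with $p$ going from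
    [b.2] to [a.2]. *)
Definition pow_hom (a b : prod_cat Lat (op_cat (Rel tau))) (f : hom a b) :
    hom (pow_alg a.1 a.2 : Alg tau) (pow_alg b.1 b.2 : Alg tau) :=
  exist _ (pow_rel_map b.1 (sval f.2) \o pow_lat_map a.2 (sval f.1))
    (alg_morphism_comp (pow_rel_map_morphism b.1 (svalP f.2))
                       (pow_lat_map_morphism a.2 (svalP f.1))).

(** The underlying functions agree by conversion, composition being associative and unital
    definitionally; [eq_exist] identifies the attached proofs. *)
Lemma pow_hom_functor : is_functor pow_hom.
Proof. by split=> *; apply: eq_exist. Qed.

End Powers.

Theorem theorem3p15 (I : Type) (tau : I -> nat) :
  (* (a) *)
  ((forall (L M : completeLat) (X : relStruct tau) (phi : L -> M),
      lat_morphism phi -> alg_morphism (pow_lat_map X phi)) /\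
   (forall (L : completeLat) (X Y : relStruct tau) (p : X -> Y),
      p_morphism p -> alg_morphism (pow_rel_map L p)) /\
   (exists F1 : forall a b : prod_cat Lat (op_cat (Rel tau)),
        hom a b ->
        hom (pow_alg a.1 a.2 : Alg tau) (pow_alg b.1 b.2 : Alg tau),
      is_functor F1 /\
      (forall (L M : Lat) (X : Rel tau) (phi : hom L M),
         sval (F1 (L, X) (M, X) (phi, cat_id X)) =
         pow_lat_map X (sval phi)) /\
      (forall (L : Lat) (X Y : Rel tau) (p : hom X Y),
         sval (F1 (L, Y) (L, X) (cat_id L, p)) =
         pow_rel_map L (sval p)))) /\
  (* (b) *)
  (forall (J : Type) (L : J -> completeLat) (X : relStruct tau),
     alg_iso (pow_alg (prod_lat L) X)
             (prod_alg (fun j => pow_alg (L j) X))) /\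
  (* (c) *)
  (forall (J : Type) (X : J -> relStruct tau) (L : completeLat),
     alg_iso (pow_alg L (disjoint_union X))
             (prod_alg (fun j => pow_alg L (X j)))) /\
  (* (d) *)
  (forall (L M : completeLat) (X : relStruct tau) (phi : L -> M),
     lat_morphism phi ->
     (injective phi -> injective (pow_lat_map X phi)) /\
     (set_surj setT setT phi -> set_surj setT setT (pow_lat_map X phi)) /\
     (inhabited X ->
        (injective (pow_lat_map X phi) -> injective phi) /\
        (set_surj setT setT (pow_lat_map X phi) ->
         set_surj setT setT phi))) /\
  (* (e) *)
  (forall (L : completeLat) (X Y : relStruct tau) (p : X -> Y),
     p_morphism p ->
     (injective p -> set_surj setT setT (pow_rel_map L p)) /\
     (set_surj setT setT p -> injective (pow_rel_map L p))).
Proof.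
split; last split; last split; last split.
- split; first exact: pow_lat_map_morphism.
  split; first exact: pow_rel_map_morphism.
  by exists (@pow_hom I tau); split; first exact: pow_hom_functor.
- exact: pow_prod_iso.
- exact: pow_disjoint_union_iso.
- move=> L M X phi _; split; first exact: pow_lat_map_inj.
  split; first exact: pow_lat_map_surj.
  by move=> X0; split; [exact: inj_pow_lat_map | exact: surj_pow_lat_map].
- move=> L X Y p _; split; [exact: pow_rel_map_surj | exact: pow_rel_map_inj].
Qed.
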